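(* Let $S\subseteq{}^*\mathbb{R}$ be an internal set. Then: (a) (Overflow of $\mathcal{F}({}^*\mathbb{R})$) If $S$ contains arbitrarily large finite positive numbers, then $S$ contains arbitrarily small infinitely large positive numbers. (b) (Underflow of $\mathcal{F}({}^*\mathbb{R})$) If $S$ contains arbitrarily small finite non-infinitesimal positive numbers, then $S$ contains arbitrarily large positive infinitesimals. (c) (Underflow of $\mathcal{L}({}^*\mathbb{R})$) If $S$ contains arbitrarily small infinitely large positive numbers, then $S$ contains arbitrarily large finite positive numbers. (d) (Overflow of $\mathcal{I}({}^*\mathbb{R})$) If $S$ contains arbitrarily large positive infinitesimals, then $S$ contains arbitrarily small finite non-infinitesimal positive numbers.
   Context: $\mathbb{R}_+$ is the set of positive real numbers and $\mathbb{N}=\{1,2,3,\dots\}$. Fix an ultrafilter $\mathcal{U}$ on $\mathbb{R}_+$ such that $(0,\tfrac1n)\in\mathcal{U}$ for all $n\in\mathbb{N}$. A property of $\varepsilon\in\mathbb{R}_+$ holds almost everywhere (a.e.) if the set of $\varepsilon$ for which it holds belongs to $\mathcal{U}$. For nets $(a_\varepsilon),(b_\varepsilon)\in\mathbb{C}^{\mathbb{R}_+}$ write $(a_\varepsilon)\sim(b_\varepsilon)$ if $a_\varepsilon=b_\varepsilon$ a.e.; $\langle a_\varepsilon\rangle$ is the equivalence class, and ${}^*\mathbb{C}=\mathbb{C}^{\mathbb{R}_+}/\!\sim$ with operations induced pointwise; $\mathbb{C}$ is embedded via constant nets. ${}^*\mathbb{R}=\{\langle a_\varepsilon\rangle : a_\varepsilon\in\mathbb{R}\text{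 a.e.}\}$, ordered by $\langle a_\varepsilon\rangle<\langle b_\varepsilon\rangle$ iff $a_\varepsilon<b_\varepsilon$ a.e. A set is internal if it is of the form $\{\langle z_\varepsilon\rangle\in{}^*\mathbb{C} : z_\varepsilon\in S_\varepsilon\text{ a.e.}\}$ for some family $(S_\varepsilon)_{\varepsilon\in\mathbb{R}_+}$ of subsets of $\mathbb{C}$. A number $x\in{}^*\mathbb{R}$ is finite ($x\in\mathcal{F}({}^*\mathbb{R})$) if $|x|\le n$ for some $n\in\mathbb{N}$; infinitesimal ($x\in\mathcal{I}({}^*\mathbb{R})$) if $|x|<\tfrac1n$ for all $n\in\mathbb{N}$; infinitely large ($x\in\mathcal{L}({}^*\mathbb{R})$) if $|x|>n$ for all $n\in\mathbb{N}$. Meaning of the phrases: ''$S$ contains arbitrarily large finite positive numbers'': for every $n\in\mathbb{N}$ there is a finite $s\in S$ with $s>n$. ''Arbitrarily small infinitely large positive numbers'': for every positive infinitely large $l\in{}^*\mathbb{R}$ there is a positive infinitely large $s\in S$ with $s<l$. ''Arbitrarily small finite non-infinitesimal positive numbers'': for every $n\in\mathbb{N}$ there is a finite, non-infinitesimal $s\in S$ with $0<s<\tfrac1n$. ''Arbitrarily large positive infinitesimals'': for every positive infinitesimal $h$ there is an infinitesimal $s\in S$ with $s>h$. *)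

(* Defs.v *)
From mathcomp Require Import all_boot all_order all_algebra.
From mathcomp Require Import generic_quotient complex.
From mathcomp Require Import boolp classical_sets filter reals interval_inference.

Set Implicit Arguments.
Unset Strict Implicit.
Unset Printing Implicit Defensive.

Import Order.TTheory GRing.Theory Num.Theory.

Local Open Scope classical_set_scope.
Local Open Scope ring_scope.
Local Open Scope quotient_scope.
Local Open Scope complex_scope.

(* Nets are indexed by the positive reals, and a property holds almost
   everywhere when it holds [\forall e \near U], U being the ultrafilter. *)
Definition net (R : realType) := {posnum R} -> R[i].

Section Hypercomplex.
Context {R : realType} (U : set_system {posnum R}) {hU : UltraFilter U}.

Definition net_eq (a b : net R) : bool := `[< \forall e \near U, a e = b e >].

Lemma net_eq_refl : reflexive net_eq.
Proof. by move=> a; apply/asboolP; exact: nearW. Qed.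

Lemma net_eq_sym : symmetric net_eq.
Proof.
by move=> a b; apply/asboolP/asboolP; apply: filterS => e ->.
Qed.

Lemma net_eq_trans : transitive net_eq.
Proof.
move=> b a c /asboolP ab /asboolP bc; apply/asboolP.
by apply: filterS2 ab bc => e -> ->.
Qed.

Canonical net_equiv := EquivRel net_eq net_eq_refl net_eq_sym net_eq_trans.

Definition starC := {eq_quot net_equiv}.

Definition cls (a : net R) : starC := \pi_starC a.

Lemma clsP (a b : net R) : cls a = cls b <-> \forall e \near U, a e = b e.
Proof.
split=> [/eqP|ab]; first by rewrite /cls eqmodE => /asboolP.
by apply/eqP; rewrite /cls eqmodE; apply/asboolP.
Qed.

Lemma repr_cls (a : net R) : \forall e \near U, repr (cls a) e = a e.
Proof. by apply/clsP; rewrite /cls reprK. Qed.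

Definition star_const (c : R[i]) : starC := cls (fun=> c).

Definition star_norm (x : starC) : starC := cls (fun e => `|repr x e|).

Lemma star_norm_cls (a : net R) : star_norm (cls a) = cls (fun e => `|a e|).
Proof. by apply/clsP; apply: filterS (repr_cls a) => e ->. Qed.

Definition starR : set starC :=
  [set x | exists2 a, x = cls a & \forall e \near U, a e \is Num.real].

(* Only used on [starR]: the order of [R[i]] extends that of [R] and only
   compares numbers with equal imaginary parts. *)
Definition star_lt (x y : starC) : Prop := \forall e \near U, repr x e < repr y e.

Lemma star_lt_cls (a b : net R) :
  star_lt (cls a) (cls b) <-> \forall e \near U, a e < b e.
Proof.
split; apply: filterS3 (repr_cls a) (repr_cls b) => e; first by move=> -> ->.
by move=> <- <-.
Qed.

Definition star_le (x y : starC) : Prop := star_lt x y \/ x = y.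

Definition internal (S : set starC) : Prop :=
  exists A : {posnum R} -> set R[i],
    S = [set x | exists2 z, x = cls z & \forall e \near U, A e (z e)].

Definition finite_star : set starC :=
  [set x | starR x /\
    exists2 n : nat, (0 < n)%N & star_le (star_norm x) (star_const n%:R)].

Definition infinitesimal : set starC :=
  [set x | starR x /\
    forall n : nat, (0 < n)%N -> star_lt (star_norm x) (star_const n%:R^-1)].

Definition infinitely_large : set starC :=
  [set x | starR x /\
    forall n : nat, (0 < n)%N -> star_lt (star_const n%:R) (star_norm x)].

Definition star_pos (x : starC) : Prop := star_lt (star_const 0) x.

Definition arb_large_finite_pos (S : set starC) : Prop :=
  forall n : nat, (0 < n)%N ->
    exists s, [/\ S s, finite_star s & star_lt (star_const n%:R) s].

Definition arb_small_infinitely_large_pos (S : set starC) : Prop :=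
  forall l, infinitely_large l -> star_pos l ->
    exists s, [/\ S s, infinitely_large s, star_pos s & star_lt s l].

Definition arb_small_finite_noninfinitesimal_pos (S : set starC) : Prop :=
  forall n : nat, (0 < n)%N ->
    exists s, [/\ S s, finite_star s, ~ infinitesimal s, star_pos s
                & star_lt s (star_const n%:R^-1)].

Definition arb_large_pos_infinitesimal (S : set starC) : Prop :=
  forall h, infinitesimal h -> star_pos h ->
    exists s, [/\ S s, infinitesimal s & star_lt h s].

End Hypercomplex.

Arguments starC {R} U {hU}.
Arguments starR {R} U {hU}.

(* Main.v *)
(* Since [e] is almost everywhere below every [1/n], one net can satisfy
   countably many internal conditions as soon as any finitely many of them can
   be satisfied.  The two spillings of the finite numbers apply this to an
   element of [S] lying between all the [n] and [l], resp. between [h] and all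
   the [1/n]; the two others apply it to an upper, resp. lower, end of a gap
   of [S]. *)
Require Import Defs.
From mathcomp Require Import all_boot all_order all_algebra.
From mathcomp Require Import complex.
From mathcomp Require Import boolp classical_sets filter reals interval_inference.

Local Open Scope classical_set_scope.
Local Open Scope ring_scope.

Import Order.TTheory GRing.Theory Num.Theory.
Local Open Scope complex_scope.

(** Choice applies at every [e] because the requirement is conditional; [t0] is the value taken
    where nothing satisfies [Q e]. *)
Lemma exists_selector (I T : Type) (t0 : T) (Q : I -> T -> Prop) :
  exists z : I -> T, forall e, (exists x, Q e x) -> Q e (z e).
Proof.
have /choice[z zQ] : forall e, exists y, (exists x, Q e x) -> Q e y.
  move=> e; have [[x Qx]|nQ] := pselect (exists x, Q e x); first by exists x.
  by exists t0 => /nQ.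
by exists z.
Qed.

(** * Choice and saturation for nets; classes read on representatives *)

Section Hypercomplex.
Context {R : realType} {U : set_system {posnum R}} {hU : UltraFilter U}.
Implicit Types (a b : net R) (x : starC U) (S : set (starC U)).
Local Notation cls := (@cls R U hU).

(** Maximality of the ultrafilter enters here: a set or its complement belongs to [U]. *)
Lemma near_not (P : {posnum R} -> Prop) :
  ~ (\forall e \near U, P e) -> \forall e \near U, ~ P e.
Proof. by move=> nP; have [/nP|] := in_ultra_setVsetC P hU. Qed.

Lemma near_choice (Q : {posnum R} -> R[i] -> Prop) :
  (\forall e \near U, exists c, Q e c) ->
  exists z : net R, \forall e \near U, Q e (z e).
Proof.
have [z zQ] := exists_selector _ _ (0 : R[i]) Q.
by move=> exQ; exists z; apply: filterS exQ.
Qed.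

Lemma cls_surj x : exists a, x = cls a.
Proof. by exists (repr x); rewrite /cls reprK. Qed.

(* [z e] meets as many of the conditions as possible, up to the bound [1/e]. *)
Lemma countable_saturation (P : nat -> {posnum R} -> R[i] -> Prop) :
    (forall n : nat, (0 < n)%N ->
       U [set e : {posnum R} | e%:num < n%:R^-1]) ->
    (forall n, \forall e \near U, exists c,
       forall m, (m <= n)%N -> P m e c) ->
  exists z : net R, forall n, \forall e \near U, P n e (z e).
Proof.
move=> U0 exP.
(* The bound on [e] caps [n], so a largest good level exists even if all levels are satisfiable at
   [e]; the shift to [n.+1] keeps level 0 from requiring [e < 0^-1 = 0]. *)
pose G e n := `[< (e%:num < n.+1%:R^-1) /\
                  exists c, forall m, (m <= n)%N -> P m e c >].
have G_bounded e n : G e n -> (n <= Num.truncn e%:num^-1)%N.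
  move=> /asboolP[en _]; rewrite truncn_ge_nat//.
  have : n.+1%:R <= e%:num^-1.
    by rewrite -[leLHS]invrK lef_pV2 ?posrE ?invr_gt0 ?ltr0n// ltW.
  by apply: le_trans; rewrite ler_nat.
have [z zP] := exists_selector _ _ (0 : R[i])
  (fun e c => forall n, G e n -> P n e c).
exists z => n; have {}exP := exP n.
have := U0 n.+1 isT; apply: filterS2 exP => e exP en.
have Gn : G e n by apply/asboolP.
apply: zP (Gn).
(* A witness for the largest good level [N] serves all good levels at once. *)
case: (ex_maxnP (ex_intro _ n Gn) (G_bounded e)) => N /asboolP[_ [c cP]] maxN.
by exists c => m /maxN /cP.
Qed.

(** Positivity in [R[i]] forces real values, so membership in [starR] is automatic and the norm
    drops out; likewise in the next two lemmas. *)
Lemma finite_star_cls a : (\forall e \near U, 0 < a e) ->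
  finite_star (cls a) <-> exists n : nat, \forall e \near U, a e <= n%:R.
Proof.
move=> a0; split=> [[_ [n _]]|[n an]].
  rewrite star_norm_cls => -[/star_lt_cls an|/clsP an]; exists n.
    by apply: filterS2 a0 an => e /gtr0_norm -> /ltW.
  by apply: filterS2 a0 an => e /gtr0_norm -> ->.
split; first by exists a => //; apply: filterS a0 => e /gtr0_real.
(* Enlarging the bound makes it positive and strict, so the [star_lt] half of [star_le] applies. *)
exists n.+1 => //; left; rewrite star_norm_cls; apply/star_lt_cls.
by apply: filterS2 a0 an => e /gtr0_norm -> /le_lt_trans; apply;
  rewrite ltr_nat.
Qed.

Lemma infinitesimal_cls a : (\forall e \near U, 0 < a e) ->
  infinitesimal (cls a) <->
  forall n : nat, (0 < n)%N -> \forall e \near U, a e < n%:R^-1.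
Proof.
move=> a0; split=> [[_ ai] n /ai|ai].
  rewrite star_norm_cls => /star_lt_cls.
  by apply: filterS2 a0 => e /gtr0_norm ->.
split; first by exists a => //; apply: filterS a0 => e /gtr0_real.
move=> n /ai {}ai; rewrite star_norm_cls; apply/star_lt_cls.
by apply: filterS2 a0 ai => e /gtr0_norm ->.
Qed.

Lemma infinitely_large_cls a : (\forall e \near U, 0 < a e) ->
  infinitely_large (cls a) <->
  forall n : nat, (0 < n)%N -> \forall e \near U, n%:R < a e.
Proof.
move=> a0; split=> [[_ al] n /al|al].
  rewrite star_norm_cls => /star_lt_cls.
  by apply: filterS2 a0 => e /gtr0_norm ->.
split; first by exists a => //; apply: filterS a0 => e /gtr0_real.
move=> n /al {}al; rewrite star_norm_cls; apply/star_lt_cls.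
by apply: filterS2 a0 al => e /gtr0_norm ->.
Qed.

(** Any representative tests membership, since two of them agree almost everywhere. *)
Lemma internal_cls S : internal S ->
  exists A : {posnum R} -> set R[i],
    forall a, S (cls a) <-> \forall e \near U, A e (a e).
Proof.
move=> [A ->]; exists A => a; split=> [[z /clsP az Az]|Aa]; last by exists a.
by apply: filterS2 az Az => e ->.
Qed.

(** * The four spilling principles *)

Section Spilling.
Hypothesis U0 : forall n : nat, (0 < n)%N ->
  U [set e : {posnum R} | e%:num < n%:R^-1].
Variables (S : set (starC U)) (Sint : internal S).

Lemma overflow_finite :
  arb_large_finite_pos S -> arb_small_infinitely_large_pos S.
Proof.
move=> Sf l; have [b ->] := cls_surj l => bl /star_lt_cls b0.
move/(infinitely_large_cls _ b0) in bl.
have [A SA] := internal_cls _ Sint.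
have [|z zP] := countable_saturation
  (fun n e c => [/\ A e c, n%:R < c & c < b e]) U0.
  move=> n; have [s] := Sf n.+1 isT.
  have [a ->] := cls_surj s => -[/SA Aa af /star_lt_cls na].
  have a0 : \forall e \near U, 0 < a e.
    by apply: filterS na => e; apply: lt_trans; rewrite ltr0n.
  have /(finite_star_cls _ a0)[k ak] := af.
  (* The standard bound [k] of [a] separates it from [b]; [k] may be 0, where [bl] says nothing,
     hence [k.+1]. *)
  apply: filter_app Aa; apply: filterS3 na ak (bl k.+1 isT) => e ne ke be Ae.
  exists (a e) => m mn; split=> //.
    by apply: lt_trans ne; rewrite ltr_nat ltnS.
  by apply: le_lt_trans ke (lt_trans _ be); rewrite ltr_nat.
have z0 : \forall e \near U, 0 < z e by apply: filterS (zP 0%N) => e [].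
exists (cls z); split.
- by apply/SA; apply: filterS (zP 0%N) => e [].
- by apply/(infinitely_large_cls _ z0) => n _; apply: filterS (zP n) => e [].
- exact/star_lt_cls.
- by apply/star_lt_cls; apply: filterS (zP 0%N) => e [].
Qed.

Lemma underflow_finite :
  arb_small_finite_noninfinitesimal_pos S -> arb_large_pos_infinitesimal S.
Proof.
move=> Sf h; have [b ->] := cls_surj h => bi /star_lt_cls b0.
move/(infinitesimal_cls _ b0) in bi.
have [A SA] := internal_cls _ Sint.
have [|z zP] := countable_saturation
  (fun n e c => [/\ A e c, b e < c & c < n.+1%:R^-1]) U0.
  move=> n; have [s] := Sf n.+1 isT.
  have [a ->] := cls_surj s.
  move=> -[/SA Aa _ ani /star_lt_cls a0 /star_lt_cls an].
  (* Failure of infinitesimality yields one standard [1/k] that separates [a] from the infinitesimal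
     [b]. *)
  have [k k0 ak] : exists2 k : nat, (0 < k)%N &
      \forall e \near U, ~ a e < k%:R^-1.
    apply: contrapT => nk; apply/ani/(infinitesimal_cls _ a0) => k k0.
    by apply: contrapT => /near_not ak; apply: nk; exists k.
  apply: filter_app Aa; apply: filter_app a0.
  apply: filterS3 an ak (bi k k0) => e ne /negP ke be ae0 Ae.
  exists (a e) => m mn; split=> //.
    apply: lt_le_trans be _.
    (* The order of [R[i]] is partial: negating [<] needs both sides real, which positivity
       gives. *)
    by rewrite real_leNgt ?gtr0_real// invr_gt0 ltr0n.
  apply: lt_le_trans ne _.
  by rewrite lef_pV2 ?posrE ?ltr0n// ler_nat ltnS.
have z0 : \forall e \near U, 0 < z e.
  by apply: filterS2 b0 (zP 0%N) => e be [_ bz _]; apply: lt_trans bz.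
exists (cls z); split.
- by apply/SA; apply: filterS (zP 0%N) => e [].
- apply/(infinitesimal_cls _ z0) => -[//|n] _.
  by apply: filterS (zP n) => e [].
- by apply/star_lt_cls; apply: filterS (zP 0%N) => e [].
Qed.

(* If [S] had no finite element above [n], saturation would give an infinitely
   large [l] with no element of [S] between [n] and [l]. *)
Lemma underflow_infinitely_large :
  arb_small_infinitely_large_pos S -> arb_large_finite_pos S.
Proof.
move=> Sl n n0; apply: contrapT => nofin.
have [A SA] := internal_cls _ Sint.
(* Otherwise points of [A e] chosen in [(n, m]] would form a finite element of [S] above [n]. *)
have gap (m : nat) : \forall e \near U,
    ~ exists c, [/\ A e c, n%:R < c & c <= m%:R].
  apply: near_not => /near_choice[z zP]; apply: nofin.
  have z0 : \forall e \near U, 0 < z e.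
    by apply: filterS zP => e [_ nz _]; apply: le_lt_trans nz.
  exists (cls z); split.
  - by apply/SA; apply: filterS zP => e [].
  - by apply/(finite_star_cls _ z0); exists m; apply: filterS zP => e [].
  - by apply/star_lt_cls; apply: filterS zP => e [].
have [|l lP] := countable_saturation (fun m e d => m%:R < d /\
    ~ exists c, [/\ A e c, n%:R < c & c <= d]) U0.
  move=> m; apply: filterS (gap m.+1) => e gape.
  (* [m.+1] exceeds every [k <= m], and the emptiness clause, independent of the index, is the gap
     up to [m.+1]. *)
  by exists m.+1%:R => k km; split=> //; rewrite ltr_nat ltnS.
have l0 : \forall e \near U, 0 < l e by apply: filterS (lP 0%N) => e [].
have [||s] := Sl (cls l); last 1 first.
- have [a ->] := cls_surj s => -[/SA Aa al /star_lt_cls a0 /star_lt_cls ltal].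
  have /(infinitely_large_cls _ a0)/(_ n n0) na := al.
  apply: (filter_not_empty U); apply: filter_app Aa.
  apply: filterS3 na ltal (lP 0%N) => e ne /ltW le [_ +] Ae; apply.
  by exists (a e).
- by apply/(infinitely_large_cls _ l0) => m _; apply: filterS (lP m) => e [].
- exact/star_lt_cls.
Qed.

(* If [S] had no noninfinitesimal element in [(0, 1/n)], saturation would give
   an infinitesimal [h > 0] with no element of [S] in [[h, 1/n)]. *)
Lemma overflow_infinitesimal :
  arb_large_pos_infinitesimal S -> arb_small_finite_noninfinitesimal_pos S.
Proof.
move=> Si n n0; apply: contrapT => nofin.
have [A SA] := internal_cls _ Sint.
(* Otherwise chosen points would form an element of [S] that is finite, as [1/n <= 1], and kept from
   being infinitesimal by the lower bound. *)
have gap (m : nat) : \forall e \near U,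
    ~ exists c, [/\ A e c, m.+1%:R^-1 <= c & c < n%:R^-1].
  apply: near_not => /near_choice[z zP]; apply: nofin.
  have z0 : \forall e \near U, 0 < z e.
    by apply: filterS zP => e [_ mz _]; apply: lt_le_trans mz;
      rewrite invr_gt0 ltr0n.
  exists (cls z); split.
  - by apply/SA; apply: filterS zP => e [].
  - apply/(finite_star_cls _ z0); exists 1%N; apply: filterS zP => e [_ _ /ltW].
    by move=> /le_trans; apply; rewrite invf_le1 ?ltr0n// ler1n.
  - move=> /(infinitesimal_cls _ z0)/(_ m.+1 isT) zm.
    apply: (filter_not_empty U); apply: filterS2 zP zm => e [_ mz _].
    by move=> /(le_lt_trans mz); rewrite ltxx.
  - exact/star_lt_cls.
  - by apply/star_lt_cls; apply: filterS zP => e [].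
have [|h hP] := countable_saturation (fun m e d => [/\ 0 < d, d < m.+1%:R^-1 &
    ~ exists c, [/\ A e c, d <= c & c < n%:R^-1]]) U0.
  move=> m; apply: filterS (gap m.+1) => e gape.
  (* [1/(m+2)] is strictly below every [1/(k+1)] with [k <= m], and is the lower end of the gap of
     index [m.+1]. *)
  exists m.+2%:R^-1 => k km; split=> //.
  by rewrite ltf_pV2 ?posrE ?ltr0n// ltr_nat !ltnS.
have h0 : \forall e \near U, 0 < h e by apply: filterS (hP 0%N) => e [].
have [||s] := Si (cls h); last 1 first.
- have [a ->] := cls_surj s => -[/SA Aa ai /star_lt_cls ha].
  have a0 : \forall e \near U, 0 < a e.
    by apply: filterS2 h0 ha => e; apply: lt_trans.
  have /(infinitesimal_cls _ a0)/(_ n n0) an := ai.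
  apply: (filter_not_empty U); apply: filter_app Aa.
  apply: filterS3 an ha (hP 0%N) => e ne /ltW le [_ _ +] Ae; apply.
  by exists (a e).
- apply/(infinitesimal_cls _ h0) => -[//|m] _.
  by apply: filterS (hP m) => e [].
- exact/star_lt_cls.
Qed.

End Spilling.
End Hypercomplex.

Theorem corollary2p10p4 (R : realType) (U : set_system {posnum R})
    (hU : UltraFilter U)
    (U0 : forall n : nat, (0 < n)%N -> U [set e : {posnum R} | e%:num < n%:R^-1])
    (S : set (starC U)) (SR : S `<=` starR U) (Sint : internal S) :
  [/\ arb_large_finite_pos S -> arb_small_infinitely_large_pos S,
      arb_small_finite_noninfinitesimal_pos S -> arb_large_pos_infinitesimal S,
      arb_small_infinitely_large_pos S -> arb_large_finite_pos S
    & arb_large_pos_infinitesimal S -> arb_small_finite_noninfinitesimal_pos S].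

Proof.
split; [exact: overflow_finite|exact: underflow_finite
  |exact: underflow_infinitely_large|exact: overflow_infinitesimal].
Qed.
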